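(* Let $K^{(1)},K^{(2)}$ be independent fractal percolations on $I=[0,1]$ with the same parameters $M\in\mathbb{N}_{\geq2}$ and $p\in(0,1]$, with construction steps $K_n^{(i)}$, and let $D_n^{(i)}:=\overline{I\setminus K_n^{(i)}}$. Then for any $n\in\mathbb{N}_0$, $\mathbb{E}V_1(D_n^{(1)}\cap D_n^{(2)})=1-2p^n+p^{2n}$, $$\mathbb{E}V_0(D_n^{(1)}\cap D_n^{(2)})=2(Mp)^n\left(1-p\frac{M-1}{M-p}\left[1-\left(\frac pM\right)^n\right]\right)+1-4p^n+2p^{2n}+(Mp^2)^n\left(-1+p^2\frac{M-1}{M-p^2}\left[1-\left(\frac{p^2}{M}\right)^n\right]\right),$$ $\mathbb{E}V_1(D_n^{(1)})=1-p^n$, and $$\mathbb{E}V_0(D_n^{(1)})=(Mp)^n\left(1-p\frac{M-1}{M-p}\left[1-\left(\frac pM\right)^n\right]\right)+1-2p^n.$$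
   Context: Fractal percolation on $[0,1]$: $K_0=[0,1]$; given $K_{n-1}$, a union of closed grid intervals of length $M^{-(n-1)}$, each is divided into $M$ closed subintervals of length $M^{-n}$, each kept independently (of everything else) with probability $p$; $K_n$ is the union of kept subintervals. $\overline{A}$ denotes closure; $V_1$ is length and $V_0$ the number of connected components. *)

(* Defs.v *)
From HB Require Import structures.
From mathcomp Require Import all_boot all_order all_algebra.
From mathcomp Require Import finmap all_classical all_reals all_analysis.
Unset Printing Implicit Defensive.
Import Order.TTheory GRing.Theory Num.Theory numFieldNormedType.Exports.
Local Open Scope classical_set_scope.
Local Open Scope ring_scope.

(* Fractal percolation on [0,1] up to construction step n, modelled on the
   finite probability space of all coin flips used in the first n steps.
   A coin for level k+1 (k < n) is attached to each grid interval of length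
   M^-(k+1), indexed by i < M^(k+1). *)
Definition coin_index (M n : nat) : finType := {k : 'I_n & 'I_(M ^ k.+1)}.
Definition config (M n : nat) : finType := {ffun coin_index M n -> bool}.

Definition grid_interval {R : realType} (M k i : nat) : set R :=
  `[(i%:R / (M ^ k)%:R), (i.+1%:R / (M ^ k)%:R)]%classic.

(* the ancestor at level j+1 of the level-n interval i is i %/ M^(n-(j+1));
   level-n interval i is kept iff all its ancestors (and itself) were kept *)
Definition survives (M n : nat) (w : config M n) (i : nat) : bool :=
  [forall k : 'I_n,
     if @insub nat (fun a => (a < M ^ k.+1)%N) 'I_(M ^ k.+1)
              (i %/ M ^ (n - k.+1))%N is Some j
     then w (existT _ k j) else false].

Definition K_step {R : realType} (M n : nat) (w : config M n) : set R :=
  \bigcup_(i in [set i : nat | (i < M ^ n)%N /\ survives M n w i]) grid_interval M n i.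

Definition D_step {R : realType} (M n : nat) (w : config M n) : set R :=
  closure (`[0, 1]%classic `\` K_step M n w).

Definition cfg_prob {R : realType} (p : R) (M n : nat) (w : config M n) : R :=
  \prod_(x : coin_index M n) (if w x then p else 1 - p).

Definition V1 {R : realType} (A : set R) : R := fine (lebesgue_measure A).

Definition components {R : realType} (A : set R) : set (set R) :=
  [set connected_component A x | x in A].

(* number of connected components (0 if infinitely many; only used for
   finite unions of intervals, where it is finite) *)
Definition V0 {R : realType} (A : set R) : R :=
  (#|` fset_set (components A)|)%fset%:R.

Definition Exp1 {R : realType} (p : R) (M n : nat) (f : config M n -> R) : R :=
  \sum_(w : config M n) cfg_prob p M n w * f w.

Definition Exp2 {R : realType} (p : R) (M n : nat)
    (f : config M n -> config M n -> R) : R :=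
  \sum_(w1 : config M n) \sum_(w2 : config M n)
     cfg_prob p M n w1 * cfg_prob p M n w2 * f w1 w2.

(* Main.v *)
Require Import Defs.
From HB Require Import structures.
From mathcomp Require Import all_boot all_order all_algebra.
From mathcomp Require Import finmap all_classical all_reals all_analysis.
From mathcomp Require Import ring lra zify.
Import Order.TTheory GRing.Theory Num.Theory numFieldNormedType.Exports.
Local Open Scope classical_set_scope.
Local Open Scope ring_scope.


(* With [N = M ^ n], the set [D_n] and the intersection of two copies of it are
   unions of open grid cells and grid points, closed under taking endpoints of
   cells.  Such a set has as many components as its Euler characteristic: the
   number of its grid points minus the number of its cells.  A cell lies in [D_n]
   iff it is dead; a grid point is missing iff its neighbouring cells (one or two)
   all survive.  For the two neighbours of an interior point [k / N] this needs
   [n + #{m < n : M ^ m divides k}] distinct coins, because the ancestors [m] levels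
   up differ iff [M ^ m] divides [k].  By independence the intersection replaces
   each factor by its square, and summing over [k] is a geometric recursion. *)

(** * Unions of grid points and open grid cells *)

(** Rescaling by [N] turns grid points into integers and avoids division. Points and open cells are
    pairwise disjoint pieces, so intersecting two such sets amounts to intersecting the
    predicates. *)
Definition cells {R : realType} (N : nat) (P E : pred nat) : set R :=
  [set x | (exists2 k, (k <= N)%N && P k & x * N%:R = k%:R)
    \/ (exists2 i, (i < N)%N && E i & i%:R < x * N%:R < i.+1%:R)].

Lemma nat_notin_cell (R : realType) (i k : nat) (y : R) :
  i%:R < y < i.+1%:R -> y <> k%:R.
Proof. by move=> /andP[+ +] yk; rewrite yk !ltr_nat ltnS; lia. Qed.

Lemma cell_uniq (R : realType) (i j : nat) (y : R) :
  i%:R < y < i.+1%:R -> j%:R < y < j.+1%:R -> i = j.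
Proof.
move=> /andP[iy yi] /andP[jy yj].
have := lt_trans iy yj; have := lt_trans jy yi.
by rewrite !ltr_nat !ltnS; lia.
Qed.

Lemma cell_cover (R : realType) (N : nat) (y : R) : (0 < N)%N ->
  0 <= y <= N%:R ->
  (exists2 k, (k <= N)%N & y = k%:R)
    \/ (exists2 i, (i < N)%N & i%:R < y < i.+1%:R).
Proof.
move=> N0 /andP[y0 yN].
have /andP[ty yt] := truncn_itv y0; set t := Num.trunc y in ty yt.
move: ty; rewrite le_eqVlt => /orP[/eqP ty|ty].
  by left; exists t => //; rewrite -(ler_nat R) ty.
right; exists t; last by rewrite ty.
by rewrite -(ltr_nat R); exact: lt_le_trans yN.
Qed.

Lemma cellsI (R : realType) (N : nat) (P1 P2 E1 E2 : pred nat) :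
  @cells R N P1 E1 `&` cells N P2 E2 = cells N (predI P1 P2) (predI E1 E2).
Proof.
apply/seteqP; split=> x.
- move=> [[[k /andP[kN Pk] xk]|[i /andP[iN Ei] xi]]
          [[l /andP[lN Pl] xl]|[j /andP[jN Ej] xj]]].
  + left; exists k => //=; rewrite kN Pk /=.
    by move: xl; rewrite xk => /eqP; rewrite eqr_nat => /eqP ->.
  + by case: (nat_notin_cell _ _ k _ xj).
  + by case: (nat_notin_cell _ _ l _ xi).
  + right; exists i => //=; rewrite iN Ei /=.
    by rewrite (cell_uniq _ _ _ _ xi xj).
- case=> [[k /= /and3P[kN Pk Pk'] xk]|[i /= /and3P[iN Ei Ei'] xi]].
  + by split; left; exists k => //; rewrite kN.
  + by split; right; exists i => //; rewrite iN.
Qed.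

Lemma mem_grid_interval (R : realType) (M n i : nat) (x : R) : (0 < M)%N ->
  grid_interval M n i x <-> i%:R <= x * (M ^ n)%:R <= i.+1%:R.
Proof.
move=> M0; have N0 : 0 < (M ^ n)%:R :> R by rewrite ltr0n expn_gt0 M0.
by rewrite /grid_interval /= in_itv /= ler_pdivrMr // ler_pdivlMr.
Qed.

Lemma segment_cells (R : realType) (N : nat) (P E : pred nat) (i : nat) :
  (0 < N)%N -> (i < N)%N -> E i -> P i -> P i.+1 ->
  [set x : R | i%:R <= x * N%:R <= i.+1%:R] `<=` cells N P E.
Proof.
move=> N0 iN Ei Pi Pi1 x /= /andP[ix xi].
move: ix; rewrite le_eqVlt => /orP[/eqP ix|ix].
  by left; exists i; rewrite ?Pi ?(ltnW iN).
move: xi; rewrite le_eqVlt => /orP[/eqP xi|xi].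
  by left; exists i.+1; rewrite ?Pi1 ?iN.
by right; exists i; rewrite ?iN ?ix.
Qed.

Lemma connected_segment (R : realType) (N : nat) (a b : R) : (0 < N)%N ->
  connected [set x : R | a <= x * N%:R <= b].
Proof.
move=> N0; have N0' : 0 < N%:R :> R by rewrite ltr0n.
apply/connected_intervalP => x y /= /andP[ax _] /andP[_ yb] z /andP[xz zy].
rewrite (le_trans ax) ?ler_pM2r //=.
by apply: le_trans yb; rewrite ler_pM2r.
Qed.

(** Removing $K_n$ may take away the endpoints of a dead cell; through this inclusion the closure in
    [D_step] restores them. *)
Lemma closure_cell (R : realType) (N i : nat) : (0 < N)%N ->
  [set x : R | i%:R <= x * N%:R <= i.+1%:R] `<=`
  closure [set x : R | i%:R < x * N%:R < i.+1%:R].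
Proof.
move=> N0; have N0' : 0 < N%:R :> R by rewrite ltr0n.
have N1 : N%:R != 0 :> R by rewrite gt_eqF.
(* An open cell is a ball around its midpoint [c], and [closed_ball] is by definition the closure of
   a ball. *)
pose c : R := (i%:R + 2^-1) / N%:R; pose r : R := 2^-1 / N%:R.
have r0 : 0 < r by rewrite divr_gt0.
have cBr : c - r = i%:R / N%:R by rewrite /c /r; field.
have cDr : c + r = i.+1%:R / N%:R by rewrite /c /r -natr1; field.
have -> : [set x : R | i%:R < x * N%:R < i.+1%:R] = ball c r.
  rewrite ball_itv cBr cDr; apply/seteqP; split => x /=;
  by rewrite in_itv /= ltr_pdivrMr // ltr_pdivlMr.
move=> x /= ix; suff : closed_ball c r x by [].
by rewrite closed_ball_itv //= in_itv /= cBr cDr ler_pdivrMr // ler_pdivlMr.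
Qed.

(** Both sides equal the union [U] of the closed dead cells. In the point predicate the tests for
    [0] and [M ^ n] let a neighbour outside $[0,1]$ count as surviving, so that it never makes the
    point belong to $D_n$. *)
Lemma D_step_cells (R : realType) (M n : nat) (w : config M n) : (0 < M)%N ->
  @D_step R M n w = cells (M ^ n)
    (fun k => ~~ (((k == 0%N) || survives M n w k.-1) &&
                  ((k == (M ^ n)%N) || survives M n w k)))
    (fun i => ~~ survives M n w i).
Proof.
move=> M0; set N := (M ^ n)%N; have N0 : (0 < N)%N by rewrite expn_gt0 M0.
have N0' : 0 < N%:R :> R by rewrite ltr0n.
pose U : set R := \bigcup_(i in [set i | (i < N)%N /\ ~~ survives M n w i])
  grid_interval M n i.
have -> : D_step M n w = U.
  apply/seteqP; split.
  - have cU : closed U.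
      apply: closed_bigcup.
        by apply: (@sub_finite_set _ _ `I_N) => // i [].
      by move=> i _; exact: itv_closed.
    rewrite ((closure_id U).1 cU); apply: closureS => x [/= ].
    rewrite in_itv /= => /andP[x0 x1] xK.
    have xN : 0 <= x * N%:R <= N%:R.
      by rewrite mulr_ge0 ?ler0n //= ler_piMl // ler0n.
    have [i iN ix] : exists2 i, (i < N)%N & i%:R <= x * N%:R <= i.+1%:R.
      case: (cell_cover _ _ _ N0 xN) => [[k kN ->]|[i iN /andP[a b]]].
        (* The point 0 is the left end of cell 0; any other grid point is taken as the right end of
           the cell before it. *)
        case: k kN => [|k] kN; first by exists 0%N; rewrite ?lexx ?ler01.
        by exists k; rewrite // lexx ler_nat leqnSn.
      by exists i; rewrite ?(ltW a) ?(ltW b).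
    exists i; last exact/mem_grid_interval.
    split => //; apply/negP => si; apply: xK; exists i => //.
    exact/mem_grid_interval.
  - move=> x [i [iN si] /(mem_grid_interval _ _ _ _ _ M0) xi].
    have := closure_cell R N i N0 x xi; apply: closureS => y /= yi.
    have /andP[iy yi1] := yi.
    split.
      rewrite /= in_itv /= -(pmulr_lge0 _ N0') (le_trans _ (ltW iy)) ?ler0n //=.
      rewrite -(ler_pM2r N0') mul1r (le_trans (ltW yi1)) // ler_nat //.
    move=> [j [jN sj] /(mem_grid_interval _ _ _ _ _ M0) /andP[jy yj]].
    (* An open cell meets a closed cell only if they have the same index, so the open dead cell [i]
       misses $K_n$. *)
    suff ij : i = j by rewrite ij sj in si.
    have := lt_le_trans iy yj; have := le_lt_trans jy yi1.
    by rewrite !ltr_nat !ltnS; lia.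
apply/seteqP; split => x.
- move=> [i [iN si] /(mem_grid_interval _ _ _ _ _ M0)].
  apply: segment_cells => //=; rewrite ?(negbTE si) ?andbF ?orbF //.
  by rewrite (ltn_eqF iN) andbF.
- case=> [[k /andP[kN Pk] xk]|[i /andP[iN si] /andP[xi ix]]]; last first.
    exists i => //; apply/mem_grid_interval => //.
    by rewrite (ltW xi) (ltW ix).
  move: Pk; rewrite negb_and !negb_or => /orP[/andP[k0 sk]|/andP[kN' sk]].
    exists k.-1; first by split => //; case: k k0 kN {sk xk}.
    apply/mem_grid_interval => //.
    by rewrite xk prednK ?lt0n // lexx ler_nat leq_pred.
  exists k; first by split => //; rewrite ltn_neqAle kN'.
  by apply/mem_grid_interval => //; rewrite xk lexx ler_nat leqnSn.
Qed.

(** * Length and number of components *)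

(** The grid points form a finite null set [Q], and the cells are disjoint, each of length $1/N$. *)
Lemma V1_cells (R : realType) (N : nat) (P E : pred nat) : (0 < N)%N ->
  V1 (@cells R N P E) = (\sum_(i < N) (E i)%:R) / N%:R.
Proof.
move=> N0; have N0' : 0 < N%:R :> R by rewrite ltr0n.
pose Q : set R := [set k%:R / N%:R | k in [set k : nat | (k <= N)%N && P k]].
pose F (i : nat) : set R :=
  if E i then `]i%:R / N%:R, i.+1%:R / N%:R[%classic else set0.
have FE i x : F i x <-> E i /\ i%:R < x * N%:R < i.+1%:R.
  rewrite /F; case: (E i); last by split => [|[]].
  by rewrite /= in_itv /= ltr_pdivrMr // ltr_pdivlMr //; split=> [|[]].
have -> : cells N P E = \big[setU/set0]_(i < N) F i `|` Q.
  rewrite -bigcup_mkord setUC; apply/seteqP; split => x.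
  - case=> [[k kN xk]|[i /andP[iN Ei] xi]].
      by left; exists k => //; rewrite -xk mulfK // gt_eqF.
    by right; exists i => //; apply/FE.
  - case=> [[k kN <-]|[i iN /FE[Ei xi]]].
      by left; exists k => //; rewrite mulfVK // gt_eqF.
    by right; exists i; rewrite // iN Ei.
have cQ : countable Q.
  apply/finite_set_countable/finite_image/(sub_finite_set _ (finite_II N.+1)).
  by move=> k /= /andP[].
have mF i : measurable (F i) by rewrite /F; case: ifP.
have mQ : measurable Q.
  by apply: countable_measurable => // t; exact: measurable_set1.
rewrite /V1 measureU0 //; last 2 first.
- by apply: bigsetU_measurable => i _; exact: mF.
- exact: countable_lebesgue_measure0.
rewrite measure_bigsetU //; last first.
  apply/trivIsetP => i j _ _ ij; apply/seteqP; split => x // [].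
  move=> /FE[_ xi] /FE[_ xj]; case/eqP: ij; exact: cell_uniq xi xj.
rewrite (eq_bigr (fun i : 'I_N => ((E i)%:R / N%:R)%:E)); last first.
  move=> i _; rewrite /F; case: (E i); last by rewrite measure0 mul0r.
  rewrite /= lebesgue_measure_itv /= lte_fin ltr_pM2r ?invr_gt0 // ltr_nat ltnSn.
  by rewrite -EFinD -mulrBl -natrB // subSnn.
by rewrite sumEFin /= mulr_suml.
Qed.

(* Each component has a unique left end, a grid point in the set whose left
   neighbouring cell is not in the set; these are the points counted. *)
Lemma V0_cells (R : realType) (N : nat) (P E : pred nat) : (0 < N)%N ->
  (forall i, (i < N)%N -> E i -> P i && P i.+1) ->
  V0 (@cells R N P E) = \sum_(k < N.+1) (P k)%:R - \sum_(i < N) (E i)%:R.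
Proof.
move=> N0 EP; have N0' : 0 < N%:R :> R by rewrite ltr0n.
have N1 : N%:R != 0 :> R by rewrite gt_eqF.
set A := cells N P E.
(* [L] marks the left ends; the guard [0 < k] is needed because [0.-1] is [0]. *)
pose L k := P k && ~~ ((0 < k)%N && E k.-1).
pose g (k : nat) : R := k%:R / N%:R.
have gN k : g k * N%:R = k%:R by rewrite /g mulfVK.
pose s := seq_fset tt [seq k <- iota 0 N.+1 | L k].
have sE k : (k \in s) = (k <= N)%N && L k.
  by rewrite seq_fsetE mem_filter mem_iota /= add0n ltnS andbC.
have Ag k : (k <= N)%N -> P k -> A (g k).
  by move=> kN Pk; left; exists k; rewrite ?kN ?gN.
(* The closed cell is a connected subset of [A], so all its points share one component. *)
have step i x : (i < N)%N -> E i -> i%:R <= x * N%:R <= i.+1%:R ->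
    connected_component A (g i) = connected_component A x.
  move=> iN Ei xi; have /andP[Pi Pi1] := EP _ iN Ei.
  apply: same_connected_component.
  apply: (@connected_component_max _ _ _ _ _ _
    (connected_segment R N i%:R i.+1%:R N0)) => //.
  - by rewrite /= gN lexx ler_nat leqnSn.
  - exact: segment_cells.
(* Walking left across cells of [A] stays in one component and stops at a left end. *)
have left k : (k <= N)%N -> P k -> exists2 j, j \in s &
    connected_component A (g j) = connected_component A (g k).
  elim: k => [|k IH] kN Pk; first by exists 0%N => //; rewrite sE /L Pk.
  case Ek : (E k); last by exists k.+1 => //; rewrite sE kN /L Pk /= Ek.
  have /andP[Pk' _] := EP _ kN Ek.
  have [j js jk] := IH (ltnW kN) Pk'; exists j => //; rewrite jk.
  by apply: step => //; rewrite gN lexx ler_nat leqnSn.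
have -> : V0 A = #|` s|%:R.
  have compE : components A = [set connected_component A (g k) | k in [set` s]].
    apply/seteqP; split => C.
    - move=> [x [[k /andP[kN Pk] xk]|[i /andP[iN Ei] xi]] <-].
        have -> : x = g k by rewrite /g -xk mulfK.
        by have [j js jk] := left _ kN Pk; exists j.
      have /andP[Pi _] := EP _ iN Ei.
      have [j js jk] := left _ (ltnW iN) Pi; exists j => //.
      rewrite jk; apply: step => //.
      by have /andP[a b] := xi; rewrite (ltW a) (ltW b).
    - move=> [k /=]; rewrite sE => /andP[kN /andP[Pk _]] <-.
      by exists (g k) => //; exact: Ag.
  rewrite /V0 compE fset_set_image; last exact: finite_fset.
  rewrite set_fsetK card_in_imfset //=.
  (* A component is convex. If it contained two left ends, it would contain the midpoint [z] of the
     cell just left of the larger one, so that cell would lie in [A], contrary to [L]. *)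
  have noteq j k : j \in s -> k \in s -> (j < k)%N ->
      connected_component A (g j) = connected_component A (g k) -> False.
    rewrite !sE => /andP[jN /andP[Pj _]] /andP[kN /andP[Pk Ek]] jk jkE.
    case: k => // k in kN Pk Ek jk jkE *.
    pose z : R := (k%:R + 2^-1) / N%:R.
    have zN : k%:R < z * N%:R < k.+1%:R.
      by rewrite /z mulfVK // -[k.+1%:R]natr1; apply/andP; split; lra.
    have : A z.
      apply: (@connected_component_sub _ _ (g k.+1)).
      have /connected_intervalP itv := @component_connected _ A (g k.+1).
      apply: (itv (g j) (g k.+1)).
      - by rewrite -jkE; apply: connected_component_refl; exact: Ag.
      - by apply: connected_component_refl; exact: Ag.
      - rewrite -(ler_pM2r N0' (g j)) -(ler_pM2r N0' z) !gN; have /andP[a b] := zN.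
        by rewrite (ltW b) andbT (le_trans _ (ltW a)) // ler_nat -ltnS.
    case=> [[l _ zl]|[i /andP[iN Ei] zi]]; first exact: nat_notin_cell zN zl.
    by move: Ek; rewrite -(cell_uniq _ _ _ _ zi zN) Ei.
  move=> j k js ks jkE; case: (ltngtP j k) => // jk.
  - by case: (noteq _ _ js ks jk jkE).
  - by case: (noteq _ _ ks js jk (esym jkE)).
rewrite size_seq_fset undup_id ?filter_uniq ?iota_uniq // size_filter.
rewrite -sum1_count /index_iota -[iota 0 N.+1]/(index_iota 0 N.+1).
rewrite big_mkord big_mkcond natr_sum.
(* Point 0 is a left end iff it is in the set. Cell [i] in the set forces point [i.+1] into it and
   stops that point from being a left end, so the count is a difference term by term. *)
rewrite [in LHS]big_ord_recl [in RHS]big_ord_recl -addrA -sumrB.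
congr (_ + _); first by rewrite /L /= andbT; case: (P 0%N).
apply: eq_bigr => i _; rewrite lift0 /L /=.
case Ei : (E i); last by rewrite andbT subr0; case: (P _).
by have /andP[_ ->] := EP _ (ltn_ord i) Ei; rewrite /= subrr.
Qed.

(* Sort the multiples [i * M] from the other indices: the former have one more
   divisor among the [M ^ m] than [i] does, the latter are divisible by [M ^ 0] only. *)
Lemma sum_geom_dvd (F : fieldType) (M n : nat) (r : F) : (0 < M)%N ->
  \sum_(0 <= k < M ^ n) r ^+ (\sum_(m < n) (M ^ m %| k)%N)%N * (M%:R - r)
  = (M%:R - 1) * r * (M%:R ^+ n - r ^+ n) + r ^+ n * (M%:R - r).
Proof.
move=> M0; elim: n => [|n IH].
  by rewrite expn0 big_nat1 big_ord0 !expr0 subrr mulr0 add0r.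
rewrite expnSr big_nat_mul.
have -> : \sum_(0 <= i < M ^ n) \sum_(i * M <= j < i.+1 * M)
      r ^+ (\sum_(m < n.+1) (M ^ m %| j)%N)%N * (M%:R - r)
  = \sum_(0 <= i < M ^ n) (r * (r ^+ (\sum_(m < n) (M ^ m %| i)%N)%N * (M%:R - r))
       + (M%:R - 1) * r * (M%:R - r)).
  apply: eq_bigr => i _.
  rewrite big_ltn; last by rewrite mulSn -[X in (X < _)%N]add0n ltn_add2r.
  congr (_ + _).
    rewrite big_ord_recl expn0 dvd1n exprD expr1 mulrA; congr (_ * _ ^+ _ * _).
    apply: eq_bigr => m _; congr nat_of_bool.
    by rewrite lift0 expnSr dvdn_pmul2r.
  rewrite (eq_big_nat _ _ (F2 := fun _ => r * (M%:R - r))).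
    rewrite sumr_const_nat.
    have -> : (i.+1 * M - (i * M).+1 = M.-1)%N by rewrite mulSn; lia.
    by rewrite -[LHS]mulr_natl -mulrA -subn1 natrB.
  move=> j /andP[ij ji]; congr (_ * _).
  rewrite big_ord_recl expn0 dvd1n big1 ?expr1 //.
  move=> m _; rewrite lift0; apply/eqP; rewrite eqb0; apply/negP => Mj.
  have {}Mj : (M %| j)%N by apply: dvdn_trans Mj; rewrite expnS dvdn_mulr.
  by case/dvdnP: Mj ij ji => q ->; rewrite !ltn_pmul2r //; lia.
rewrite big_split /= -mulr_sumr IH sumr_const_nat subn0.
rewrite -[_ *+ (M ^ n)]mulr_natl natrX.
rewrite !exprSr; ring.
Qed.

(** * Survival probabilities and linearity of expectation *)

Section Expectation.
Variables (R : realType) (p : R) (M n : nat).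
Hypothesis M0 : (0 < M)%N.
Local Notation N := (M ^ n)%N.

(** The sum over configurations factors into one sum per coin: a coin in [h] contributes $p$, any
    other $p+(1-p)=1$. *)
Lemma sum_cfg_prob_forced (h : pred (coin_index M n)) :
  \sum_(w : config M n) cfg_prob p M n w * (\prod_(x | h x) (w x)%:R)
  = \prod_(x | h x) p.
Proof.
transitivity (\sum_(w : config M n)
    \prod_x ((if w x then p else 1 - p) * (if h x then (w x)%:R else 1))).
  by apply: eq_bigr => w _; rewrite big_split /= -big_mkcond.
rewrite -(bigA_distr_bigA
  (fun x (b : bool) => (if b then p else 1 - p) * (if h x then b%:R else 1))).
rewrite [RHS]big_mkcond; apply: eq_bigr => x _.
by rewrite big_bool /=; case: (h x); rewrite ?mulr1 ?mulr0 ?addr0 // addrC subrK.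
Qed.

Lemma ancestor_lt (i : nat) (k : 'I_n) : (i < N)%N ->
  (i %/ M ^ (n - k.+1) < M ^ k.+1)%N.
Proof.
by move=> iN; rewrite ltn_divLR ?expn_gt0 ?M0 // -expnD subnKC.
Qed.

Lemma prod_coins (h : forall k : 'I_n, pred 'I_(M ^ k.+1))
    (f : coin_index M n -> R) :
  \prod_(x | h (tag x) (tagged x)) f x
  = \prod_(k < n) \prod_(j | h k j) f (existT _ k j).
Proof.
rewrite (sig_big_dep xpredT h (fun k j => f (existT _ k j))).
by apply: eq_big => -[].
Qed.

(** For [i < M ^ n] all ancestor indices are in range, so [survives] never takes its default
    [false]. The product form is the one [sum_cfg_prob_forced] evaluates. *)
Lemma survivesE (w : config M n) (i : nat) : (i < N)%N ->
  (survives M n w i)%:R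
  = \prod_(x : coin_index M n | tagged x == (i %/ M ^ (n - (tag x).+1))%N :> nat)
      (w x)%:R :> R.
Proof.
move=> iN.
rewrite (prod_coins (fun k j => j == (i %/ M ^ (n - k.+1))%N :> nat)).
have -> : (survives M n w i)%:R
    = \prod_(k < n) (w (existT _ k (Ordinal (ancestor_lt i k iN))))%:R :> R.
  rewrite /survives; case: forallP => [H|/forallP].
    apply: esym; apply: big1 => k _.
    by have := H k; rewrite (insubT (fun a => a < M ^ k.+1)%N (ancestor_lt i k iN)) => ->.
  rewrite negb_forall => /existsP[k].
  rewrite (insubT (fun a => a < M ^ k.+1)%N (ancestor_lt i k iN)) => /negbTE wk.
  by rewrite (bigD1 k) //= wk mul0r.
apply: eq_bigr => k _.
by rewrite (big_pred1 (Ordinal (ancestor_lt i k iN))).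
Qed.

(** Both cells survive iff every coin in the union of the two ancestries is a success. Each level
    contributes one coin if the ancestors agree and two otherwise. *)
Lemma Exp1_survives2 (i j : nat) : (i < N)%N -> (j < N)%N ->
  Exp1 p M n (fun w => (survives M n w i && survives M n w j)%:R)
  = p ^+ (n + \sum_(m < n) (i %/ M ^ m != j %/ M ^ m)%N)%N.
Proof.
move=> iN jN.
pose anc i (x : coin_index M n) :=
  tagged x == (i %/ M ^ (n - (tag x).+1))%N :> nat.
transitivity (\prod_(x | anc i x || anc j x) p).
  rewrite -sum_cfg_prob_forced; apply: eq_bigr => w _; congr (_ * _).
  rewrite -mulnb natrM !survivesE // big_mkcond [X in _ * X]big_mkcond.
  rewrite -big_split [RHS]big_mkcond; apply: eq_bigr => x _ /=.
  rewrite -/(anc i x) -/(anc j x).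
  (* A shared coin occurs in both products, but its value is 0 or 1 and equals its own square. *)
  by case: (anc i x); case: (anc j x); case: (w x); rewrite ?mulr1 ?mulr0.
rewrite /anc (prod_coins (fun k l => (l == (i %/ M ^ (n - k.+1))%N :> nat)
  || (l == (j %/ M ^ (n - k.+1))%N :> nat))).
have -> : (n + \sum_(m < n) (i %/ M ^ m != j %/ M ^ m)
           = \sum_(m < n) (1 + (i %/ M ^ m != j %/ M ^ m)))%N.
  by rewrite big_split /= sum1_card card_ord.
(* Coin levels count down from the top, [m] counts up from level [n]; reversing the index matches
   them. *)
rewrite expr_sum [RHS](reindex_inj rev_ord_inj); apply: eq_bigr => k _ /=.
set a := Ordinal (ancestor_lt i k iN); set b := Ordinal (ancestor_lt j k jN).
rewrite (eq_bigl (mem [set a; b]%SET)); last by move=> l; rewrite !inE.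
by rewrite prodr_const cards2.
Qed.

Lemma Exp1_survives (i : nat) : (i < N)%N ->
  Exp1 p M n (fun w => (survives M n w i)%:R) = p ^+ n.
Proof.
move=> iN; rewrite -[X in _ ^+ X]addn0.
have -> : (0 = \sum_(m < n) (i %/ M ^ m != i %/ M ^ m))%N.
  by rewrite big1 // => m _; rewrite eqxx.
by rewrite -Exp1_survives2 //; apply: eq_bigr => w _; rewrite andbb.
Qed.

Lemma eq_Exp1 (f g : config M n -> R) :
  f =1 g -> Exp1 p M n f = Exp1 p M n g.
Proof. by move=> fg; apply: eq_bigr => w _; rewrite fg. Qed.

Lemma eq_Exp2 (f g : config M n -> config M n -> R) :
  f =2 g -> Exp2 p M n f = Exp2 p M n g.
Proof.
by move=> fg; apply: eq_bigr => w1 _; apply: eq_bigr => w2 _; rewrite fg.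
Qed.

Lemma Exp1_cst (c : R) : Exp1 p M n (fun=> c) = c.
Proof.
have := sum_cfg_prob_forced xpred0; rewrite big_pred0 // => H.
rewrite /Exp1 -mulr_suml -[RHS]mul1r -H; congr (_ * _).
by apply: eq_bigr => w _; rewrite big_pred0 ?mulr1.
Qed.

Lemma Exp1B (f g : config M n -> R) :
  Exp1 p M n (fun w => f w - g w) = Exp1 p M n f - Exp1 p M n g.
Proof. by rewrite /Exp1 -sumrB; apply: eq_bigr => w _; rewrite mulrBr. Qed.

Lemma Exp1_sum (I : finType) (f : I -> config M n -> R) :
  Exp1 p M n (fun w => \sum_i f i w) = \sum_i Exp1 p M n (f i).
Proof.
by rewrite /Exp1 exchange_big; apply: eq_bigr => w _; rewrite mulr_sumr.
Qed.

Lemma Exp1Mr (f : config M n -> R) (c : R) :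
  Exp1 p M n (fun w => f w * c) = Exp1 p M n f * c.
Proof. by rewrite /Exp1 mulr_suml; apply: eq_bigr => w _; rewrite mulrA. Qed.

Lemma Exp2E (f : config M n -> config M n -> R) :
  Exp2 p M n f = Exp1 p M n (fun w1 => Exp1 p M n (f w1)).
Proof.
apply: eq_bigr => w1 _; rewrite mulr_sumr.
by apply: eq_bigr => w2 _; rewrite mulrA.
Qed.

(** This is the independence of the two percolations: the product weight separates the double
    sum. *)
Lemma Exp2M (f g : config M n -> R) :
  Exp2 p M n (fun w1 w2 => f w1 * g w2) = Exp1 p M n f * Exp1 p M n g.
Proof.
rewrite /Exp2 mulr_suml; apply: eq_bigr => w1 _; rewrite mulr_sumr.
by apply: eq_bigr => w2 _; rewrite mulrACA.
Qed.

Lemma Exp2B (f g : config M n -> config M n -> R) :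
  Exp2 p M n (fun w1 w2 => f w1 w2 - g w1 w2) = Exp2 p M n f - Exp2 p M n g.
Proof.
rewrite !Exp2E -Exp1B; apply: eq_bigr => w1 _; congr (_ * _); exact: Exp1B.
Qed.

Lemma Exp2Mr (f : config M n -> config M n -> R) (c : R) :
  Exp2 p M n (fun w1 w2 => f w1 w2 * c) = Exp2 p M n f * c.
Proof.
rewrite !Exp2E -Exp1Mr; apply: eq_bigr => w1 _; congr (_ * _); exact: Exp1Mr.
Qed.

Lemma Exp2_sum (I : finType) (f : I -> config M n -> config M n -> R) :
  Exp2 p M n (fun w1 w2 => \sum_i f i w1 w2) = \sum_i Exp2 p M n (f i).
Proof.
rewrite Exp2E; under [RHS]eq_bigr do rewrite Exp2E.
rewrite -Exp1_sum; apply: eq_bigr => w1 _; congr (_ * _); exact: Exp1_sum.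
Qed.

End Expectation.
(* The grid point [k / N] is missing from [D_n]; the first and last point have only
   one neighbouring cell. *)
Definition point_kept (M n : nat) (w : config M n) (k : nat) : bool :=
  ((k == 0%N) || survives M n w k.-1) && ((k == (M ^ n)%N) || survives M n w k).

(** This supplies the endpoint hypothesis of [V0_cells], for one copy of $D_n$ and for the
    intersection. *)
Lemma dead_cell_endpoints (M n : nat) (w : config M n) (i : nat) :
  (i < M ^ n)%N -> ~~ survives M n w i ->
  ~~ point_kept M n w i && ~~ point_kept M n w i.+1.
Proof.
move=> iN /negbTE si; rewrite /point_kept /= si (ltn_eqF iN) /= andbF.
by [].
Qed.

Lemma natrN_bool (F : pzRingType) (b : bool) : (~~ b)%:R = 1 - b%:R :> F.
Proof. by case: b; rewrite ?subrr ?subr0. Qed.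

(** * The functionals as indicator sums, and their expected terms *)

Section ExpectedFunctionals.
Variables (R : realType) (p : R) (M n : nat).
Hypothesis M0 : (0 < M)%N.
Local Notation N := (M ^ n)%N.
Local Notation D w := (@D_step R M n w).
Local Notation s w i := ((survives M n w i)%:R : R).
Local Notation a w k := ((point_kept M n w k)%:R : R).

Let N0 : (0 < N)%N. Proof. by rewrite expn_gt0 M0. Qed.

Lemma V1_D_step w : V1 (D w) = (\sum_(i < N) (1 - s w i)) / N%:R.
Proof.
rewrite D_step_cells // V1_cells //; congr (_ / _).
by apply: eq_bigr => i _; rewrite natrN_bool.
Qed.

Lemma V1_D_stepI w1 w2 : V1 (D w1 `&` D w2)
  = (\sum_(i < N) (1 - s w1 i) * (1 - s w2 i)) / N%:R.
Proof.
rewrite !D_step_cells // cellsI V1_cells //; congr (_ / _).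
by apply: eq_bigr => i _; rewrite /= -mulnb natrM !natrN_bool.
Qed.

Lemma V0_D_step w : V0 (D w)
  = \sum_(k < N.+1) (1 - a w k) - \sum_(i < N) (1 - s w i).
Proof.
rewrite D_step_cells // V0_cells //; last exact: dead_cell_endpoints.
by congr (_ - _); apply: eq_bigr => i _; rewrite natrN_bool.
Qed.

Lemma V0_D_stepI w1 w2 : V0 (D w1 `&` D w2)
  = \sum_(k < N.+1) (1 - a w1 k) * (1 - a w2 k)
    - \sum_(i < N) (1 - s w1 i) * (1 - s w2 i).
Proof.
rewrite !D_step_cells // cellsI V0_cells //.
  by congr (_ - _); apply: eq_bigr => i _; rewrite /= -mulnb natrM !natrN_bool.
move=> i iN /= /andP[d1 d2].
have /andP[-> ->] := dead_cell_endpoints _ _ _ _ iN d1.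
by have /andP[-> ->] := dead_cell_endpoints _ _ _ _ iN d2.
Qed.

Lemma Exp1_dead (i : 'I_N) : Exp1 p M n (fun w => 1 - s w i) = 1 - p ^+ n.
Proof. by rewrite Exp1B Exp1_cst Exp1_survives. Qed.

Lemma Exp1_point_kept_bound (k : nat) : (k == 0%N) || (k == N) ->
  Exp1 p M n (fun w => a w k) = p ^+ n.
Proof.
case/orP => /eqP ->; rewrite /point_kept /=.
- rewrite ltn_eqF //=; exact: Exp1_survives.
- have N1 : (N.-1 < N)%N by rewrite prednK.
  rewrite -(Exp1_survives _ p _ _ M0 _ N1); apply: eq_bigr => w _.
  by rewrite eqxx andbT (gtn_eqF N0).
Qed.

Lemma Exp1_point_kept (k : nat) : (0 < k < N)%N ->
  Exp1 p M n (fun w => a w k)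
  = p ^+ n * p ^+ (\sum_(m < n) (M ^ m %| k)%N)%N.
Proof.
move=> /andP[k0 kN]; rewrite /point_kept (gtn_eqF k0) (ltn_eqF kN) /=.
rewrite Exp1_survives2 // ?(leq_ltn_trans (leq_pred _)) // -exprD.
congr (_ ^+ (_ + _)); apply: eq_bigr => m _; congr nat_of_bool.
have d0 : (0 < M ^ m)%N by rewrite expn_gt0 M0.
(* The quotient of [k.-1] is that of [k] minus 1 exactly when $M^m$ divides [k]. As [k] is positive,
   the quotient of [k] is then at least 1, so truncated subtraction really lowers it. *)
rewrite divn_pred; case: (boolP (_ %| k)%N) => dk; last by rewrite subn0 eqxx.
have : (0 < k %/ M ^ m)%N by rewrite divn_gt0 // dvdn_leq.
by lia.
Qed.

(** [F] is left general to serve both cases: $1-x$ for one set and $(1-x)^2$ for the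
    intersection. *)
Lemma sum_Exp1_point_kept (F : R -> R) :
  \sum_(k < N.+1) F (Exp1 p M n (fun w => a w k))
  = 2 * F (p ^+ n)
    + \sum_(1 <= k < N) F (p ^+ n * p ^+ (\sum_(m < n) (M ^ m %| k)%N)%N).
Proof.
rewrite -(big_mkord xpredT (fun k => F (Exp1 p M n (fun w => a w k)))).
rewrite big_nat_recr //= big_ltn // !Exp1_point_kept_bound ?eqxx ?orbT //.
rewrite addrAC -mulr2n mulr_natl; congr (_ + _).
by apply: eq_big_nat => k kN; rewrite Exp1_point_kept.
Qed.

Lemma sum_interior_dvd (r : R) : r != M%:R ->
  \sum_(1 <= k < N) r ^+ (\sum_(m < n) (M ^ m %| k)%N)%N
  = (M%:R - 1) * r * (M%:R ^+ n - r ^+ n) / (M%:R - r).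
Proof.
move=> rM; have Mr : M%:R - r != 0 by rewrite subr_eq0 eq_sym.
apply: (mulIf Mr); rewrite divfK //.
(* The added term is that of [k = 0]: every $M^m$ divides 0, so its exponent is [n]. *)
apply: (addIr (r ^+ n * (M%:R - r))); rewrite -sum_geom_dvd // -mulr_suml.
rewrite -mulrDl [in RHS]big_ltn // addrC; congr ((_ ^+ _ + _) * _).
rewrite -[LHS]card_ord -sum1_card; apply: eq_bigr => m _.
by rewrite dvdn0.
Qed.
End ExpectedFunctionals.

(** * Assembling the four formulas *)

Theorem theorem5p8 (R : realType) (M : nat) (p : R) (n : nat) :
  (2 <= M)%N -> 0 < p -> p <= 1 ->
  let Mr : R := M%:R in
  [/\ Exp2 p M n (fun w1 w2 => V1 (D_step M n w1 `&` D_step M n w2))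
        = 1 - 2 * p ^+ n + p ^+ (2 * n),
      Exp2 p M n (fun w1 w2 => V0 (D_step M n w1 `&` D_step M n w2))
        = 2 * (Mr * p) ^+ n
            * (1 - p * ((Mr - 1) / (Mr - p)) * (1 - (p / Mr) ^+ n))
          + 1 - 4 * p ^+ n + 2 * p ^+ (2 * n)
          + (Mr * p ^+ 2) ^+ n
            * (-1 + p ^+ 2 * ((Mr - 1) / (Mr - p ^+ 2)) * (1 - (p ^+ 2 / Mr) ^+ n)),
      Exp1 p M n (fun w => V1 (D_step M n w)) = 1 - p ^+ n
    & Exp1 p M n (fun w => V0 (D_step M n w))
        = (Mr * p) ^+ n * (1 - p * ((Mr - 1) / (Mr - p)) * (1 - (p / Mr) ^+ n))
          + 1 - 2 * p ^+ n ].
Proof.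
move=> M2 p0 p1 Mr; have M0 : (0 < M)%N := ltnW M2.
have MrE : M%:R = Mr by [].
have NE : (M ^ n)%:R = Mr ^+ n by rewrite natrX.
have Mr2 : 2 <= Mr by rewrite ler_nat.
have Mr0 : Mr != 0 by rewrite gt_eqF //; lra.
have Mrn0 : Mr ^+ n != 0 by rewrite expf_neq0.
have pp1 : p ^+ 2 <= 1 by rewrite expr_le1 // ltW.
(* Both $p$ and $p^2$ are at most 1, below $M \geq 2$, so the denominators do not vanish. *)
have pM : p != Mr by rewrite lt_eqF //; lra.
have ppM : p ^+ 2 != Mr by rewrite lt_eqF //; lra.
have Mp : Mr - p != 0 by rewrite subr_eq0 eq_sym.
have Mpp : Mr - p ^+ 2 != 0 by rewrite subr_eq0 eq_sym.
have p2n : p ^+ (2 * n) = (p ^+ n) ^+ 2 by rewrite mulnC exprM.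
have n1 : (M ^ n - 1)%:R = Mr ^+ n - 1 :> R.
  by rewrite natrB ?expn_gt0 ?M0 // NE.
have E2dead : Exp2 p M n (fun w1 w2 => \sum_(i < M ^ n)
    (1 - (survives M n w1 i)%:R) * (1 - (survives M n w2 i)%:R))
    = Mr ^+ n * (1 - p ^+ n) ^+ 2.
  rewrite Exp2_sum (eq_bigr (fun=> (1 - p ^+ n) ^+ 2)).
    by rewrite sumr_const card_ord -[LHS]mulr_natl NE.
  by move=> i _; rewrite Exp2M !Exp1_dead.
have E1dead : Exp1 p M n (fun w => \sum_(i < M ^ n) (1 - (survives M n w i)%:R))
    = Mr ^+ n * (1 - p ^+ n).
  rewrite Exp1_sum (eq_bigr (fun=> 1 - p ^+ n)).
    by rewrite sumr_const card_ord -[LHS]mulr_natl NE.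
  by move=> i _; rewrite Exp1_dead.
split.
- by rewrite (eq_Exp2 _ _ _ _ _ _ (V1_D_stepI R M n M0))
    Exp2Mr E2dead NE p2n; field; rewrite Mrn0.
- rewrite (eq_Exp2 _ _ _ _ _ _ (V0_D_stepI R M n M0)).
  rewrite Exp2B E2dead Exp2_sum.
  under eq_bigr do rewrite Exp2M Exp1B Exp1_cst //.
  rewrite (sum_Exp1_point_kept _ _ _ _ M0 (fun x => (1 - x) * (1 - x))).
  (* Expanding the square leaves a constant, a divisor sum with ratio $p$ and one with ratio $p^2$,
     each summed by [sum_interior_dvd]. *)
  rewrite (eq_bigr (fun k => 1
      - 2 * p ^+ n * p ^+ (\sum_(m < n) (M ^ m %| k)%N)%N
      + (p ^+ n) ^+ 2 * (p ^+ 2) ^+ (\sum_(m < n) (M ^ m %| k)%N)%N)); last first.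
    by move=> k _; rewrite [(p ^+ 2) ^+ _]exprAC; ring.
  rewrite big_split sumrB /= -!mulr_sumr !sum_interior_dvd // sumr_const_nat n1.
  rewrite p2n !exprMn !exprVn MrE; field.
  by rewrite Mp Mpp Mrn0.
- by rewrite (eq_Exp1 _ _ _ _ _ _ (V1_D_step R M n M0))
    Exp1Mr E1dead NE; field; rewrite Mrn0.
- rewrite (eq_Exp1 _ _ _ _ _ _ (V0_D_step R M n M0)).
  rewrite Exp1B E1dead Exp1_sum.
  under eq_bigr do rewrite Exp1B Exp1_cst //.
  rewrite (sum_Exp1_point_kept _ _ _ _ M0 (fun x => 1 - x)).
  rewrite sumrB /= -!mulr_sumr !sum_interior_dvd // sumr_const_nat n1.
  rewrite !exprMn !exprVn MrE; field.
  by rewrite Mp Mrn0.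
Qed.
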